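(* For $|q|<1$, the function $e(q)$ satisfies the differential equation $$q\frac{de}{dq}=\frac{e\mathcal{P}-\mathcal{Q}}{2}.$$
   Context: For $|q|<1$ define $$\mathcal{P}(q)=1+8\sum_{n=1}^{\infty}\frac{(-1)^{n-1}nq^n}{1-q^n},\quad e(q)=1+24\sum_{n=1}^{\infty}\frac{nq^n}{1+q^n},\quad \mathcal{Q}(q)=1-16\sum_{n=1}^{\infty}\frac{(-1)^{n-1}n^3q^n}{1-q^n}.$$ *)

(* Defs.v *)
From Stdlib Require Import Reals.
From Coquelicot Require Import Coquelicot.

Open Scope C_scope.

(* sum_{n >= 1} a n, as the limit [iota] of the partial sums; [iota] makes it
   total, so the value is unspecified when the series diverges. *)
Definition Csum1 (a : nat -> C) : C :=
  @iota C_CompleteNormedModule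
    (@is_series C_AbsRing C_NormedModule (fun k : nat => a (S k))).

Definition fun_P (q : C) : C :=
  1 + 8 * Csum1 (fun n => (- (1)) ^ (n - 1) * INR n * q ^ n / (1 - q ^ n)).

Definition fun_e (q : C) : C :=
  1 + 24 * Csum1 (fun n => INR n * q ^ n / (1 + q ^ n)).

Definition fun_Q (q : C) : C :=
  1 - 16 * Csum1 (fun n => (- (1)) ^ (n - 1) * INR n ^ 3 * q ^ n / (1 - q ^ n)).

(* Main.v *)
(* Expanding the three Lambert series in powers of [q] turns the equation into
   [2 n e_n = sum_(i <= n) e_i P_(n - i) - Q_n]. The convolution is a sum of
   [a b (-1)^(x + b)] over the positive solutions of [a x + b y = n]. The substitution
   [a x + b y = a (x - y) + (a + b) y] maps the solutions with [x > y] bijectively onto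
   those with [b > a]. Hence for weights [G], [K] with
   [K (a, x, b, y) = G (a, x - y, a + b, y)] for [x > y], and symmetrically for [x < y],
   the sums of [G] and [K] differ only by the contributions of [a = b] and of [x = y],
   which are sums over the divisors of [n].
   On the analytic side every interchange of sums is made on partial sums: two finite
   sums differ in polynomially many terms, each at most [N ^ k * |q| ^ N]. *)
From HB Require Import structures.
From Stdlib Require Import ZArith.
From mathcomp Require Import all_boot all_algebra zify ssrZ ring.
Set Implicit Arguments. Unset Strict Implicit. Unset Printing Implicit Defensive.
Import GRing.Theory.
Local Open Scope ring_scope.

(** * Sums over the solutions of [a x + b y = n] *)

(** The maps have to be mutually inverse only on the two lists, which admits truncated subtraction
    and Euclidean division. *)
Lemma sum_bij (V : nmodType) (T U : eqType) (s : seq T) (t : seq U)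
    (h : T -> U) (h' : U -> T) (F : U -> V) :
  uniq s -> uniq t ->
  {in s, forall x, h x \in t /\ h' (h x) = x} ->
  {in t, forall y, h' y \in s /\ h (h' y) = y} ->
  \sum_(y <- t) F y = \sum_(x <- s) F (h x).
Proof.
move=> us ut hs ht; rewrite -(big_map h xpredT F).
apply: perm_big; apply: uniq_perm => // [|y].
  rewrite map_inj_in_uniq // => x x' /hs[_ {2}<-] /hs[_ {2}<-] -> //.
apply/idP/mapP => [/ht[yt <-]|[x /hs[xs _] ->//]].
by exists (h' y).
Qed.

Definition quad : eqType := ((nat * nat) * (nat * nat))%type.

(** An entry is [((a, x), (b, y))]. Positive solutions have all components at most [n], so the
    finite box loses none. *)
Definition quads (n : nat) : seq quad :=
  let r := [seq (a, x) | a <- iota 1 n, x <- iota 1 n] in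
  [seq t <- [seq (p, p') | p <- r, p' <- r]
     | t.1.1 * t.1.2 + t.2.1 * t.2.2 == n]%N.

Lemma quads_uniq n : uniq (quads n).
Proof.
apply/filter_uniq/allpairs_uniq; try by apply: allpairs_uniq; rewrite ?iota_uniq // => -[? ?] [? ?].
by move=> [? ?] [? ?].
Qed.

Lemma mem_quads n a x b y :
  (((a, x), (b, y)) \in quads n) =
  [&& 0 < a, 0 < x, 0 < b, 0 < y & a * x + b * y == n]%N.
Proof.
rewrite mem_filter /= andbC.
apply/andP/and5P => [[/allpairsP[[p p'] /= [hp hp' [ep ep']]] e]|[a0 x0 b0 y0 e]].
  subst p p'; move: hp hp'.
  move=> /allpairsP[[? ?] /= [h1 h2 [? ?]]] /allpairsP[[? ?] /= [h3 h4 [? ?]]].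
  by subst; move: h1 h2 h3 h4; rewrite !mem_iota; split=> //; lia.
split=> //; apply: allpairs_f; apply: allpairs_f; rewrite mem_iota; move/eqP: e; nia.
Qed.

(* Unlike [divisors], this list is empty at [0]. *)
Definition divs (n : nat) : seq nat := [seq d <- iota 1 n | (d %| n)%N].

Lemma divs_uniq n : uniq (divs n).
Proof. exact/filter_uniq/iota_uniq. Qed.

Lemma mem_divs n d : (d \in divs n) = (0 < n)%N && (d %| n)%N.
Proof.
rewrite mem_filter mem_iota andbC; case: n => [|n] /=; first by case: d.
case dn: (d %| n.+1)%N; rewrite ?andbF // andbT add1n ltnS.
by rewrite (dvdn_gt0 _ dn) // dvdn_leq.
Qed.

Lemma dvd_div n d : d \in divs n -> [/\ 0 < d, 0 < n %/ d & d * (n %/ d) = n]%N.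
Proof.
rewrite mem_divs => /andP[n0 dn].
by rewrite divn_gt0 ?(dvdn_gt0 n0 dn) // dvdn_leq // mulnC divnK.
Qed.

Lemma mul_divs d x : (0 < d -> 0 < x -> d \in divs (d * x) /\ d * x %/ d = x)%N.
Proof. by move=> d0 x0; rewrite mem_divs muln_gt0 d0 x0 dvdn_mulr // mulKn. Qed.

(** A solution determines [k = a x], and given [k] the numbers [x] and [y] are quotients, so
    solutions correspond to triples [(k, (a, b))]. The ends [k = 0] and [k = n] contribute nothing,
    because [divs 0] is empty. *)
Lemma sum_conv_quads (R : comNzRingType) (F F' : nat -> nat -> R) n :
  \sum_(k < n.+1) (\sum_(a <- divs k) F a (k %/ a)%N) *
    (\sum_(b <- divs (n - k)) F' b ((n - k) %/ b)%N) =
  \sum_(t <- quads n) F t.1.1 t.1.2 * F' t.2.1 t.2.2.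
Proof.
pose tr := [seq (k, p) | k <- iota 0 n.+1,
                         p <- [seq (a, b) | a <- divs k, b <- divs (n - k)]].
have tr_mem k a b : ((k, (a, b)) \in tr) =
    [&& k <= n, a \in divs k & b \in divs (n - k)]%N.
  apply/allpairsPdep/and3P =>
    [[k' [[a' b'] [hk /allpairsP[[a2 b2] /= [h1 h2 [? ?]]] [? ? ?]]]]|[hk ha hb]].
    by subst; move: hk; rewrite mem_iota; split => //; lia.
  exists k, (a, b); split=> //; first by rewrite mem_iota; lia.
  exact: allpairs_f.
rewrite (@sum_bij _ _ _ tr _
   (fun t => ((t.2.1, t.1 %/ t.2.1), (t.2.2, (n - t.1) %/ t.2.2)))%N
   (fun t => (t.1.1 * t.1.2, (t.1.1, t.2.1)))%N).
- rewrite big_allpairs_dep -[iota 0 n.+1]/(index_iota 0 n.+1) big_mkord.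
  apply: eq_bigr => k _; rewrite big_allpairs_dep mulr_suml.
  by apply: eq_bigr => a _; rewrite mulr_sumr.
- apply: allpairs_uniq_dep => [|k _|]; first exact: iota_uniq.
    by apply: allpairs_uniq; rewrite ?divs_uniq // => -[? ?] [? ?].
  by move=> [? ?] [? ?] _ _ /= [-> ->].
- exact: quads_uniq.
- move=> [k [a b]]; rewrite tr_mem => /and3P[kn /dvd_div[a0 x0 e] /dvd_div[b0 y0 e']] /=.
  by rewrite mem_quads a0 x0 b0 y0 e e' subnKC // eqxx.
- move=> [[a x] [b y]]; rewrite mem_quads => /and5P[a0 x0 b0 y0 /eqP e] /=.
  rewrite tr_mem -e addKn.
  by have [-> ->] := mul_divs a0 x0; have [-> ->] := mul_divs b0 y0; rewrite leq_addr.
Qed.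

Lemma sum_quads_swap (V : nmodType) (F : nat -> nat -> nat -> nat -> V)
    n (P : nat -> nat -> nat -> nat -> bool) :
  \sum_(t <- quads n | P t.1.1 t.1.2 t.2.1 t.2.2) F t.1.1 t.1.2 t.2.1 t.2.2 =
  \sum_(t <- quads n | P t.2.1 t.2.2 t.1.1 t.1.2) F t.2.1 t.2.2 t.1.1 t.1.2.
Proof.
rewrite big_mkcond [RHS]big_mkcond /=.
apply: (@sum_bij _ _ _ (quads n) _ (fun t => (t.2, t.1)) (fun t => (t.2, t.1))
  (fun t => if P t.1.1 t.1.2 t.2.1 t.2.2 then F t.1.1 t.1.2 t.2.1 t.2.2 else 0));
  rewrite ?quads_uniq //;
  by move=> [[a x] [b y]]; rewrite !mem_quads => /and5P[-> -> -> ->]; rewrite addnC.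
Qed.

(** The inverse substitution is [(a, x + y, b - a, y)]. The conditions [a < b] and [y < x] are what
    makes [b - a] and [x - y] positive. *)
Lemma sum_quads_shear (V : nmodType) (G : nat -> nat -> nat -> nat -> V) n :
  \sum_(t <- quads n | (t.1.1 < t.2.1)%N) G t.1.1 t.1.2 t.2.1 t.2.2 =
  \sum_(t <- quads n | (t.2.2 < t.1.2)%N)
     G t.1.1 (t.1.2 - t.2.2)%N (t.1.1 + t.2.1)%N t.2.2.
Proof.
rewrite -big_filter -[RHS]big_filter.
apply: (@sum_bij _ _ _ _ _
  (fun t => ((t.1.1, t.1.2 - t.2.2), (t.1.1 + t.2.1, t.2.2)))%N
  (fun t => ((t.1.1, t.1.2 + t.2.2), (t.2.1 - t.1.1, t.2.2)))%N
  (fun t => G t.1.1 t.1.2 t.2.1 t.2.2)).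
- exact/filter_uniq/quads_uniq.
- exact/filter_uniq/quads_uniq.
- move=> [[a x] [b y]]; rewrite mem_filter /= mem_quads => /andP[xy /and5P[a0 x0 b0 y0 /eqP e]].
  rewrite mem_filter /= mem_quads.
  split; last by do 2!congr (_, _); lia.
  by apply/andP; split; [lia | apply/and5P; split; nia].
- move=> [[a x] [b y]]; rewrite mem_filter /= mem_quads => /andP[xy /and5P[a0 x0 b0 y0 /eqP e]].
  rewrite mem_filter /= mem_quads.
  split; last by do 2!congr (_, _); lia.
  by apply/andP; split; [lia | apply/and5P; split; nia].
Qed.

Lemma sum_trichotomy (V : nmodType) (I : Type) (s : seq I) (f g : I -> nat) (F : I -> V) :
  \sum_(t <- s) F t = \sum_(t <- s | f t == g t) F t +
    (\sum_(t <- s | (f t < g t)%N) F t + \sum_(t <- s | (g t < f t)%N) F t).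
Proof.
rewrite (bigID (fun t => f t == g t)) /=; congr (_ + _).
rewrite (bigID (fun t => f t < g t)%N) /=; congr (_ + _); apply: eq_bigl => t; lia.
Qed.

(** The sum of [G] is cut by comparing [a] with [b], that of [K] by comparing [x] with [y]. The
    shear and its mirror image under exchange of the two pairs match the strict parts, so only the
    diagonals survive. *)
Lemma sum_quads_diff (V : zmodType) (G K : nat -> nat -> nat -> nat -> V) n :
  (forall a x b y, 0 < x -> K a (x + y)%N b y = G a x (a + b)%N y)%N ->
  (forall a x b y, 0 < y -> K a x b (x + y)%N = G (a + b)%N x b y)%N ->
  \sum_(t <- quads n) G t.1.1 t.1.2 t.2.1 t.2.2 -
  \sum_(t <- quads n) K t.1.1 t.1.2 t.2.1 t.2.2 =
  \sum_(t <- quads n | t.1.1 == t.2.1) G t.1.1 t.1.2 t.2.1 t.2.2 -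
  \sum_(t <- quads n | t.1.2 == t.2.2) K t.1.1 t.1.2 t.2.1 t.2.2.
Proof.
move=> h1 h2.
rewrite (@sum_trichotomy _ _ _ (fun t => t.1.1) (fun t => t.2.1)).
rewrite [in X in _ - X](@sum_trichotomy _ _ _ (fun t => t.2.2) (fun t => t.1.2)).
rewrite sum_quads_shear.
(* The part [b < a] is exchanged into [a < b], sheared, and exchanged back. *)
rewrite (sum_quads_swap (fun a x b y => G a x b y) n (fun a x b y => b < a)%N).
rewrite (sum_quads_shear (fun a x b y => G b y a x)).
rewrite (sum_quads_swap (fun a x b y => G (a + b)%N y a (x - y)%N) n (fun a x b y => y < x)%N).
under [X in _ + (X + _) - _]eq_bigr => t txy.
  rewrite -h1 ?subn_gt0 // subnK; last exact: ltnW. over.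
under [X in _ + (_ + X) - _]eq_bigr => t txy.
  rewrite addnC -h2 ?subn_gt0 // subnKC; last exact: ltnW. over.
under [X in _ - (X + _)]eq_bigl => t do rewrite eq_sym.
by rewrite opprD addrA addrAC addrK.
Qed.

(** With [a = b = d] the equation reads [d (x + y) = n]. *)
Lemma sum_quads_eq1 (V : nmodType) (F : nat -> nat -> nat -> nat -> V) n :
  \sum_(t <- quads n | t.1.1 == t.2.1) F t.1.1 t.1.2 t.2.1 t.2.2 =
  \sum_(d <- divs n) \sum_(1 <= y < n %/ d) F d (n %/ d - y)%N d y.
Proof.
rewrite -(@big_allpairs_dep _ _ _ _ (fun=> nat) _ (fun d y => (d, y)) (divs n)
  (fun d => index_iota 1 (n %/ d)) (fun p => F p.1 (n %/ p.1 - p.2)%N p.1 p.2)).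
rewrite -[LHS]big_filter.
apply: (@sum_bij _ (nat * nat)%type quad _ _
  (fun p => ((p.1, n %/ p.1 - p.2), (p.1, p.2)))%N
  (fun t => (t.1.1, t.2.2))
  (fun t => F t.1.1 t.1.2 t.2.1 t.2.2)).
- apply: allpairs_uniq_dep => [|d _|]; rewrite ?divs_uniq ?iota_uniq //.
  by move=> [? ?] [? ?] _ _ /= [-> ->].
- exact/filter_uniq/quads_uniq.
- move=> _ /allpairsPdep[d [y [/dvd_div[d0 x0 e] hy ->]]] /=.
  rewrite mem_index_iota in hy; rewrite mem_filter mem_quads /= eqxx; split=> //.
  apply/and5P; split=> //; nia.
- move=> [[a x] [b y]]; rewrite mem_filter mem_quads /= => /andP[/eqP <- /and5P[a0 x0 b0 y0 /eqP e]].
  have en : n = (a * (x + y))%N by rewrite -e mulnDr.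
  have xy0 : (0 < x + y)%N by lia.
  have [ha e'] := mul_divs a0 xy0; rewrite en e' addnK; split=> //.
  apply: allpairs_f_dep => //; rewrite e' mem_index_iota; lia.
Qed.

(** With [x = y] the equation reads [(a + b) x = n], and the divisor is [d = a + b]. *)
Lemma sum_quads_eq2 (V : nmodType) (F : nat -> nat -> nat -> nat -> V) n :
  \sum_(t <- quads n | t.1.2 == t.2.2) F t.1.1 t.1.2 t.2.1 t.2.2 =
  \sum_(d <- divs n) \sum_(1 <= a < d) F a (n %/ d)%N (d - a)%N (n %/ d)%N.
Proof.
rewrite -(@big_allpairs_dep _ _ _ _ (fun=> nat) _ (fun d y => (d, y)) (divs n)
  (fun d => index_iota 1 d) (fun p => F p.2 (n %/ p.1)%N (p.1 - p.2)%N (n %/ p.1)%N)).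
rewrite -[LHS]big_filter.
apply: (@sum_bij _ (nat * nat)%type quad _ _
  (fun p => ((p.2, n %/ p.1), (p.1 - p.2, n %/ p.1)))%N
  (fun t => (t.1.1 + t.2.1, t.1.1))%N
  (fun t => F t.1.1 t.1.2 t.2.1 t.2.2)).
- apply: allpairs_uniq_dep => [|d _|]; rewrite ?divs_uniq ?iota_uniq //.
  by move=> [? ?] [? ?] _ _ /= [-> ->].
- exact/filter_uniq/quads_uniq.
- move=> _ /allpairsPdep[d [a [/dvd_div[d0 x0 e] ha ->]]] /=.
  rewrite mem_index_iota in ha; rewrite mem_filter mem_quads /= eqxx; split.
    by apply/and5P; split=> //; nia.
  by congr (_, _); lia.
- move=> [[a x] [b y]]; rewrite mem_filter mem_quads /= => /andP[/eqP <- /and5P[a0 x0 b0 _ /eqP e]].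
  have en : n = ((a + b) * x)%N by rewrite -e mulnDl.
  have ab0 : (0 < a + b)%N by lia.
  rewrite en; have [ha ->] := mul_divs ab0 x0; rewrite addKn; split=> //.
  apply: allpairs_f_dep => //; rewrite mem_index_iota; lia.
Qed.

(** The coefficient of [q ^ n] in the sum over [d] of [f d * q ^ d / (1 - eps * q ^ d)]: a
    factorization [n = d m] contributes [f d * eps ^ (m - 1)]. The parameter [eps] covers both
    denominators, [1 + q ^ d] and [1 - q ^ d]. *)
Definition lambert (R : nzRingType) (f : nat -> R) (eps : R) (n : nat) : R :=
  \sum_(d <- divs n) f d * eps ^+ (n %/ d).-1.

(** * Signs, power sums and the convolution identity for divisor sums *)

Definition sg (k : nat) : Z := (-1) ^+ k.

Lemma sgD j k : sg (j + k) = sg j * sg k.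
Proof. exact: exprD. Qed.

Lemma sgS k : sg k.+1 = - sg k.
Proof. by rewrite /sg exprS mulN1r. Qed.

Lemma sg_pred k : (0 < k)%N -> sg k.-1 = - sg k.
Proof. by case: k => // k _; rewrite sgS opprK. Qed.

Lemma sg_sqr k : sg k * sg k = 1.
Proof. by rewrite -sgD addnn /sg -signr_odd odd_double. Qed.

Lemma sg_cases k : sg k = 1 \/ sg k = -1.
Proof. by rewrite /sg -signr_odd; case: odd; [right | left]. Qed.

Lemma sg_sub k j : (j <= k)%N -> sg (k - j) = sg k * sg j.
Proof. by move=> jk; rewrite -{2}(subnK jk) sgD -mulrA sg_sqr mulr1. Qed.

(** The factor 2 here, like 2 and 6 in the next two lemmas, clears the denominator of the closed
    form in [Z]. *)
Lemma sum_sg n : (0 < n)%N -> 2 * (\sum_(1 <= i < n) sg i) = - (1 + sg n).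
Proof.
case: n => // n _; elim: n => [|n IH]; first by rewrite big_geq.
rewrite big_nat_recr // mulrDr IH (sgS n.+1); ring.
Qed.

Lemma sum_sqr_sg n : (0 < n)%N ->
  2 * (\sum_(1 <= i < n) i%:R ^+ 2 * sg i) = - (sg n * n%:R * (n%:R - 1)).
Proof.
case: n => // n _; elim: n => [|n IH]; first by rewrite big_geq //= subrr !mulr0 oppr0.
rewrite big_nat_recr // mulrDr IH (sgS n.+1) -[n.+2%:R]natr1; ring.
Qed.

Lemma sum_sqr n : (0 < n)%N ->
  6 * (\sum_(1 <= i < n) i%:R ^+ 2) = n%:R * (n%:R - 1) * (2 * n%:R - 1) :> Z.
Proof.
case: n => // n _; elim: n => [|n IH]; first by rewrite big_geq //= subrr mulr0 mul0r.
rewrite big_nat_recr // mulrDr IH -[n.+2%:R]natr1; ring.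
Qed.

(* The three sign characters form one orbit under the substitutions
   [(a, x, b, y) -> (a, x - y, a + b, y)] and [(a + b, x, b, y - x)]. The squares are chosen so that,
   up to exchanging [(a, x)] and [(b, y)], the difference of the weights is [- 4 a b sg (b + x)]. *)
Definition weightG (a x b y : nat) : Z :=
  (a%:R - b%:R) ^+ 2 * sg (b + x) + b%:R ^+ 2 * sg (a + y) + a%:R ^+ 2 * sg (a + b + x + y).
Definition weightK (a x b y : nat) : Z :=
  a%:R ^+ 2 * sg (b + x) + (a%:R + b%:R) ^+ 2 * sg (a + y) + b%:R ^+ 2 * sg (a + b + x + y).

(** With a prime for the exchange of the two pairs, [weightG - weightK = -2 (U + U') + W - W']
    pointwise. The exchange preserves sums over [quads n], so the [W] terms cancel and the [U] terms
    combine. *)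
Lemma sum_quads_GK n :
  -4 * (\sum_(t <- quads n) t.1.1%:R * t.2.1%:R * sg (t.2.1 + t.1.2)) =
  \sum_(t <- quads n) weightG t.1.1 t.1.2 t.2.1 t.2.2 -
  \sum_(t <- quads n) weightK t.1.1 t.1.2 t.2.1 t.2.2.
Proof.
pose U a x b (y : nat) : Z := a%:R * b%:R * sg (b + x).
pose W a x b y := b%:R ^+ 2 * sg (b + x) + a%:R ^+ 2 * sg (a + b + x + y).
have -> : -4 * (\sum_(t <- quads n) U t.1.1 t.1.2 t.2.1 t.2.2) =
   -2 * (\sum_(t <- quads n) U t.1.1 t.1.2 t.2.1 t.2.2)
   -2 * (\sum_(t <- quads n) U t.1.1 t.1.2 t.2.1 t.2.2)
   + ((\sum_(t <- quads n) W t.1.1 t.1.2 t.2.1 t.2.2)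
   - \sum_(t <- quads n) W t.1.1 t.1.2 t.2.1 t.2.2) by ring.
rewrite {2}(sum_quads_swap U n (fun _ _ _ _ => true)).
rewrite {2}(sum_quads_swap W n (fun _ _ _ _ => true)).
rewrite !mulr_sumr -!sumrB -big_split /=; apply: eq_bigr => -[[a x] [b y]] _ /=.
by rewrite /U /W /weightG /weightK !sgD; ring.
Qed.

(** By [sum_quads_GK] and [sum_quads_diff] only the two diagonals remain, which are sums over the
    divisors [d] of [n]. With [n = d v] and the inner sums in closed form, both sides agree for each
    [d] separately. *)
Lemma lambert_conv n :
  24 * (\sum_(k < n.+1) lambert (fun d => d%:R) (-1) k *
                        lambert (fun d => sg d.-1 * d%:R) 1 (n - k)%N) =
  6 * n%:R * lambert (fun d => d%:R) (-1) n - 3 * lambert (fun d => d%:R) (-1) n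
  - lambert (fun d => sg d.-1 * d%:R) 1 n
  - 2 * lambert (fun d => sg d.-1 * d%:R ^+ 3) 1 n :> Z.
Proof.
rewrite /lambert.
rewrite (sum_conv_quads (fun a x => a%:R * (-1) ^+ x.-1)
          (fun b y => sg b.-1 * b%:R * 1 ^+ y.-1)).
have -> : \sum_(t <- quads n) t.1.1%:R * (-1) ^+ t.1.2.-1 *
            (sg t.2.1.-1 * t.2.1%:R * 1 ^+ t.2.2.-1) =
          \sum_(t <- quads n) t.1.1%:R * t.2.1%:R * sg (t.2.1 + t.1.2).
  rewrite !big_seq; apply: eq_bigr => -[[a x] [b y]].
  rewrite mem_quads => /and5P[a0 x0 b0 y0 _] /=.
  by rewrite expr1n -[(-1) ^+ _]/(sg _) !sg_pred // sgD; ring.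
set S := \sum_(t <- quads n) _.
(* The 6 clears the denominators of the three closed forms used at the end. *)
have -> : 24 * S = -6 * (-4 * S) by ring.
rewrite sum_quads_GK (sum_quads_diff (G := weightG) (K := weightK)); first last.
(* The substitution repeats some letters inside [sg]; fixing their signs makes the resulting squares
   of signs equal to 1. *)
- move=> a x b y _; rewrite /weightK /weightG !sgD natrD.
  by case: (sg_cases x) => ->; case: (sg_cases b) => ->; ring.
- move=> a x b y _; rewrite /weightK /weightG !sgD natrD.
  by case: (sg_cases a) => ->; case: (sg_cases y) => ->; ring.
rewrite sum_quads_eq1 sum_quads_eq2 -sumrB !mulr_sumr -!sumrB !big_seq.
apply: eq_bigr => d /dvd_div[]; set v := (n %/ d)%N => d0 v0 <-.
(* On this diagonal [(a - b) ^ 2] vanishes and [x + y = v]. *)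
have -> : \sum_(1 <= y < v) weightG d (v - y) d y =
          d%:R ^+ 2 * (sg d * (\sum_(1 <= y < v) sg y) + sg v * (v%:R - 1)).
  rewrite -(natrB _ v0) mulrDr !mulrA mulr_natr -sumr_const_nat mulr_sumr -big_split /=.
  rewrite !big_nat; apply: eq_bigr => y /andP[_ yv].
  by rewrite /weightG -addnA subnK ?(ltnW yv) // !sgD; case: (sg_cases d) => ->; ring.
have -> : \sum_(1 <= a < d) weightK a v (d - a) v =
   sg d * sg v * (\sum_(1 <= a < d) a%:R ^+ 2 * sg a) + d%:R ^+ 2 * sg v * (\sum_(1 <= a < d) sg a)
   + sg d * (\sum_(1 <= a < d) a%:R ^+ 2).
  (* Reversal turns the squares of [a] into the squares of [d - a] that occur in [weightK]. *)
  rewrite [in X in _ + X]big_nat_rev /= !mulr_sumr -!big_split /= !big_nat.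
  apply: eq_bigr => a /andP[_ ad]; rewrite add1n subSS.
  rewrite /weightK subnKC ?(ltnW ad) // !sgD (sg_sub (ltnW ad)) -natrD subnKC ?(ltnW ad) //.
  by case: (sg_cases v) => ->; ring.
rewrite -[(-1) ^+ _]/(sg _) !sg_pred // !expr1n natrM.
have e1 := sum_sg v0; have e2 := sum_sg d0; have e3 := sum_sqr_sg d0; have e4 := sum_sqr d0.
set X1 := \sum_(1 <= y < v) _ in e1 *; set X2 := \sum_(1 <= i < d) sg i in e2 *.
set X3 := \sum_(1 <= i < d) _ * _ in e3 *; set X4 := \sum_(1 <= i < d) _ in e4 *.
transitivity (-3 * d%:R ^+ 2 * sg d * (2 * X1) - 6 * d%:R ^+ 2 * sg v * (v%:R - 1) +
  3 * sg d * sg v * (2 * X3) + 3 * d%:R ^+ 2 * sg v * (2 * X2) + sg d * (6 * X4)); first by ring.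
by rewrite e1 e2 e3 e4; case: (sg_cases d) => ->; ring.
Qed.

Definition coef_e n : Z := (n == 0)%:R + 24 * lambert (fun d => d%:R) (-1) n.
Definition coef_P n : Z := (n == 0)%:R + 8 * lambert (fun d => sg d.-1 * d%:R) 1 n.
Definition coef_Q n : Z := (n == 0)%:R - 16 * lambert (fun d => sg d.-1 * d%:R ^+ 3) 1 n.

(** Let [A] and [P] be the Lambert sums inside [coef_e] and [coef_P]. The constant terms contribute
    [24 A n + 8 P n] to the convolution; eight times [lambert_conv] cancels these together with the
    cubic sum of [coef_Q] and leaves [48 n A n]. *)
Lemma coef_ode n :
  \sum_(k < n.+1) coef_e k * coef_P (n - k)%N - coef_Q n = 2 * (n%:R * coef_e n).
Proof.
rewrite /coef_e /coef_P /coef_Q.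
set A := lambert _ (-1); set P := lambert _ 1; set Q := lambert _ 1 n.
have -> : \sum_(k < n.+1) ((k == 0 :> nat)%:R + 24 * A k) * (((n - k)%N == 0)%:R + 8 * P (n - k)%N)
   = \sum_(k < n.+1) (k == 0 :> nat)%:R * (((n - k)%N == 0)%:R + 8 * P (n - k)%N)
   + 24 * (\sum_(k < n.+1) ((n - k)%N == 0)%:R * A k)
   + 8 * (24 * \sum_(k < n.+1) A k * P (n - k)%N).
  by rewrite !mulr_sumr -!big_split /=; apply: eq_bigr => k _; ring.
have -> : \sum_(k < n.+1) ((n - k)%N == 0)%:R * A k = A n.
  rewrite big_ord_recr big1 ?subnn ?mul1r ?add0r //= => i _.
  by rewrite subn_eq0 leqNgt ltn_ord mul0r.
rewrite lambert_conv -/A -/(P n) -/Q big_ord_recl subn0 mul1r big1 ?addr0 => [|i _]; last first.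
  by rewrite mul0r.
by clearbody Q; case: eqVneq => [->|_]; rewrite ?mulr1n ?mulr0n; ring.
Qed.

(** * Limits and power series over the complex numbers *)

From Stdlib Require Import Reals Lra.
Require Import Defs.
From Coquelicot Require Import Coquelicot.
Delimit Scope ring_scope with ring.
Delimit Scope R_scope with R.
Delimit Scope nat_scope with N.
Close Scope ring_scope.
Open Scope C_scope.

(** These instances open the big-operator lemmas, distributivity included, to [Cplus] and
    [Cmult]. *)
HB.instance Definition _ :=
  Monoid.isComLaw.Build C (RtoC 0) Cplus Cplus_assoc Cplus_comm Cplus_0_l.
HB.instance Definition _ :=
  Monoid.isMulLaw.Build C (RtoC 0) Cmult Cmult_0_l Cmult_0_r.
HB.instance Definition _ := Monoid.isAddLaw.Build C Cmult Cplus
  (fun x y z => Cmult_plus_distr_r x y z) (fun x y z => Cmult_plus_distr_l x y z).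

Local Notation "\sum_ ( i < n ) F" := (\big[Cplus/RtoC 0]_(i < n) F%C) : C_scope.
Local Notation "\sum_ ( i <- s ) F" := (\big[Cplus/RtoC 0]_(i <- s) F%C) : C_scope.

Lemma Cmod_sum_seq_le (I : eqType) (s : seq I) (F : I -> C) (B : R) :
  (forall i, i \in s -> (Cmod (F i) <= B)%R) -> (Cmod (\sum_(i <- s) F i) <= INR (size s) * B)%R.
Proof.
elim: s => [|x s IH] h; first by rewrite big_nil Cmod_0 /=; lra.
rewrite big_cons [size _]/= S_INR.
apply: Rle_trans (Cmod_triangle _ _) _.
have := h x (mem_head x s); have := IH (fun i hi => h i (@mem_behead _ (x :: s) i hi)); lra.
Qed.

Lemma Cmod_sum_le (n : nat) (F : nat -> C) (B : R) :
  (forall i, (i < n)%N -> (Cmod (F i) <= B)%R) -> (Cmod (\sum_(i < n) F i) <= INR n * B)%R.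
Proof.
move=> h; rewrite -(big_mkord xpredT F).
have -> : INR n = INR (size (index_iota 0 n)) by rewrite size_iota subn0.
by apply: Cmod_sum_seq_le => i; rewrite mem_index_iota => /andP[_ /h].
Qed.

(** Stated through real distances, so that squeezing and comparison are done with real sequences. *)
Definition Clim (u : nat -> C) (l : C) : Prop := is_lim_seq (fun n => Cmod (u n - l)) 0%R.

Lemma Clim_filterlim (u : nat -> C) (l : C) :
  Clim u l <-> filterlim u eventually (@locally C_NormedModule l).
Proof.
rewrite (@filterlim_locally_ball_norm _ _ C_NormedModule) /Clim; split => h.
  move=> eps; have /= := proj2 (is_lim_seq_spec _ _) h eps.
  move=> [N hN]; exists N => n /hN.
  by rewrite Rminus_0_r Rabs_pos_eq //; exact: Cmod_ge_0.
apply/is_lim_seq_spec => /= eps; have [N hN] := h eps; exists N => n /hN.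
by rewrite Rminus_0_r Rabs_pos_eq //; exact: Cmod_ge_0.
Qed.

Lemma Clim_squeeze (u : nat -> C) (l : C) (w : nat -> R) :
  (forall n, Cmod (u n - l) <= w n)%R -> is_lim_seq w 0%R -> Clim u l.
Proof.
move=> h hw; apply: (is_lim_seq_le_le (fun=> 0%R) _ w) => // [n|].
  by split => //; exact: Cmod_ge_0.
exact: is_lim_seq_const.
Qed.

Lemma Clim_unique (u : nat -> C) (l l' : C) : Clim u l -> Clim u l' -> l = l'.
Proof.
move=> /Clim_filterlim h /Clim_filterlim h'.
exact: (@filterlim_locally_unique _ _ C_NormedModule _ (Proper_StrongProper _ eventually_filter) u).
Qed.

Lemma Clim_ext (u v : nat -> C) (l : C) : (forall n, u n = v n) -> Clim u l -> Clim v l.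
Proof. by move=> e; apply: is_lim_seq_ext => n; rewrite e. Qed.

Lemma Clim_const (a : C) : Clim (fun=> a) a.
Proof.
apply: (is_lim_seq_ext (fun=> 0%R)); last exact: is_lim_seq_const.
by move=> _; rewrite -Cmod_0; congr Cmod; ring.
Qed.

Lemma Clim_add (u v : nat -> C) (l m : C) :
  Clim u l -> Clim v m -> Clim (fun n => u n + v n) (l + m).
Proof.
move=> hu hv; apply: (Clim_squeeze (w := fun n => (Cmod (u n - l) + Cmod (v n - m))%R)).
  move=> n; apply: Rle_trans (Cmod_triangle _ _); apply: Req_le; congr Cmod; ring.
by have := is_lim_seq_plus' _ _ _ _ hu hv; rewrite Rplus_0_r.
Qed.

Lemma Clim_scal (u : nat -> C) (l a : C) : Clim u l -> Clim (fun n => a * u n) (a * l).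
Proof.
move=> hu; apply: (Clim_squeeze (w := fun n => (Cmod a * Cmod (u n - l))%R)).
  by move=> n; rewrite -Cmod_mult; apply: Req_le; congr Cmod; ring.
by have := is_lim_seq_scal_l _ (Cmod a) _ hu; rewrite /= Rmult_0_r.
Qed.

(** Both interchanges of sums below, in the Cauchy product and in the Lambert series, are made in
    this form. *)
Lemma Clim_close (u v : nat -> C) (l : C) (w : nat -> R) :
  Clim u l -> (forall n, Cmod (v n - u n) <= w n)%R -> is_lim_seq w 0%R -> Clim v l.
Proof.
move=> hu h hw; apply: (Clim_ext (u := fun n => u n + (v n - u n))); first by move=> n; ring.
rewrite -[l]Cplus_0_r; apply: Clim_add => //; apply: Clim_squeeze hw => n.
by apply: Rle_trans (h n); apply: Req_le; congr Cmod; ring.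
Qed.

Lemma Clim_bounded (u : nat -> C) (l : C) : Clim u l -> exists B, forall n, (Cmod (u n) <= B)%R.
Proof.
move=> /Clim_filterlim h.
have [B hB] := @filterlim_bounded _ C_NormedModule u (ex_intro _ l h).
by exists B => n; exact: hB.
Qed.

Lemma Clim_mul (u v : nat -> C) (l m : C) :
  Clim u l -> Clim v m -> Clim (fun n => u n * v n) (l * m).
Proof.
move=> hu hv; have [B hB] := Clim_bounded hv.
have hB0 : (0 <= B)%R by apply: Rle_trans (hB 0%N); exact: Cmod_ge_0.
apply: (Clim_squeeze (w := fun n => (Cmod (u n - l) * B + Cmod l * Cmod (v n - m))%R)).
  move=> n; have -> : u n * v n - l * m = (u n - l) * v n + l * (v n - m) by ring.
  apply: Rle_trans (Cmod_triangle _ _) _; rewrite !Cmod_mult.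
  have := Rmult_le_compat_l _ _ _ (Cmod_ge_0 (u n - l)) (hB n); lra.
have := is_lim_seq_plus' _ _ _ _ (is_lim_seq_scal_r _ B _ hu) (is_lim_seq_scal_l _ (Cmod l) _ hv).
by rewrite /= Rmult_0_l Rmult_0_r Rplus_0_r.
Qed.

Lemma Clim_Cmod_le (u : nat -> C) (l : C) (B : R) :
  Clim u l -> (forall n, (Cmod (u n) <= B)%R) -> (Cmod l <= B)%R.
Proof.
move=> hu hB.
have hle n : (Cmod l <= Cmod (u n - l) + B)%R.
  have -> : l = - (u n - l) + u n by ring.
  apply: Rle_trans (Cmod_triangle _ _) _; rewrite Cmod_opp.
  have -> : u n - (- (u n - l) + u n) = u n - l by ring.
  have := hB n; lra.
have h0 : is_lim_seq (fun n => (Cmod (u n - l) + B)%R) (0 + B)%R.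
  by apply: is_lim_seq_plus' => //; exact: is_lim_seq_const.
have := is_lim_seq_le _ _ _ _ hle (is_lim_seq_const _) h0.
by rewrite /= Rplus_0_l.
Qed.

Lemma ex_series_pow_geom (k : nat) (r : R) :
  (0 <= r < 1)%R -> ex_series (fun n => INR n.+1 ^ k * r ^ n)%R.
Proof.
(* The ratio test needs nonzero terms and [r] may be 0, so it is applied to some [s] strictly
   between [r] and 1. *)
move=> [r0 r1]; set s := ((r + 1) / 2)%R.
have s0 : (0 < s)%R by rewrite /s; lra.
have s1 : (s < 1)%R by rewrite /s; lra.
have rs : (r <= s)%R by rewrite /s; lra.
have pos n : (0 < INR n.+1)%R by apply: lt_0_INR; lia.
have pos' n : (0 < INR n.+1 ^ k * s ^ n)%R.
  by apply: Rmult_lt_0_compat; apply: pow_lt.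
apply: (@ex_series_le _ R_CompleteNormedModule _ (fun n => Rabs (INR n.+1 ^ k * s ^ n)%R)).
  move=> n; rewrite /norm /= /abs /= -/(INR n.+1) !Rabs_pos_eq; try exact: Rlt_le.
    by apply: Rmult_le_compat_l; [apply/pow_le/Rlt_le | apply: pow_incr; lra].
  by apply: Rmult_le_pos; [apply/pow_le/Rlt_le | apply: pow_le].
apply: (@ex_series_DAlembert _ s) => // [n|]; first exact/Rgt_not_eq.
have h1 : is_lim_seq (fun n => INR n.+2 / INR n.+1)%R 1%R.
  apply: (is_lim_seq_ext (fun n => 1 + / INR n.+1)%R).
    by move=> n; rewrite (S_INR n.+1); field; exact/Rgt_not_eq.
  have -> : Finite 1%R = Finite (1 + 0)%R by congr Finite; ring.
  apply: is_lim_seq_plus'; first exact: is_lim_seq_const.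
  apply: (proj1 (is_lim_seq_incr_1 (fun n => / INR n)%R 0%R)).
  by apply: (is_lim_seq_inv INR p_infty is_lim_seq_INR).
have h2 : is_lim_seq (fun n => (INR n.+2 / INR n.+1) ^ k)%R 1%R.
  elim: k {pos'} => [|k IH]; first by apply: (is_lim_seq_ext (fun=> 1%R)) => //; exact: is_lim_seq_const.
  have -> : Finite 1%R = Finite (1 * 1)%R by congr Finite; ring.
  exact: is_lim_seq_mult'.
apply: (is_lim_seq_ext (fun n => (INR n.+2 / INR n.+1) ^ k * s)%R).
  move=> n; rewrite Rabs_pos_eq; last by apply/Rlt_le/Rdiv_lt_0_compat.
  rewrite Rpow_mult_distr pow_inv -/(INR n.+2) [(s ^ n.+1)%R]/=; field.
  by split; apply/Rgt_not_eq => //; apply: pow_lt.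
by have := is_lim_seq_scal_r _ s _ h2; rewrite /= Rmult_1_l.
Qed.

Lemma lim_pow_geom (k : nat) (r : R) :
  (0 <= r < 1)%R -> is_lim_seq (fun n => INR n.+1 ^ k * r ^ n)%R 0%R.
Proof. by move=> hr; apply/ex_series_lim_0/ex_series_pow_geom. Qed.

Lemma sum_n_big (a : nat -> C) (n : nat) :
  @sum_n C_AbelianMonoid a n = \sum_(i < n.+1) a i.
Proof.
elim: n => [|n IH]; first by rewrite sum_O big_ord_recr big_ord0 /= Cplus_0_l.
by rewrite sum_Sn IH [RHS]big_ord_recr.
Qed.

(** * Power series with coefficients of polynomial growth *)

Definition psum (c : nat -> C) (q : C) (N : nat) : C := \sum_(n < N) (c n * q ^ n).

Definition poly_growth (c : nat -> C) : Prop :=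
  exists M k, (0 <= M)%R /\ forall n, (Cmod (c n) <= M * INR n.+1 ^ k)%R.

Lemma INR_succ_ge1 n : (1 <= INR n.+1)%R.
Proof. by rewrite S_INR; have := pos_INR n; lra. Qed.

Lemma Clim_succ (u : nat -> C) (l : C) : Clim (fun n => u n.+1) l <-> Clim u l.
Proof.
rewrite /Clim; exact: iff_sym (is_lim_seq_incr_1 (fun n => Cmod (u n - l)) 0%R).
Qed.

Lemma is_series_Clim (a : nat -> C) (l : C) :
  @is_series C_AbsRing C_NormedModule a l <-> Clim (fun N => \sum_(n < N) a n) l.
Proof.
rewrite -Clim_succ Clim_filterlim /is_series.
by split; apply: filterlim_ext => n; rewrite sum_n_big.
Qed.

Lemma psum_add (c d : nat -> C) (q : C) N : psum (fun n => c n + d n) q N = psum c q N + psum d q N.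
Proof. by rewrite /psum -big_split; apply: eq_bigr => i _ /=; ring. Qed.

Lemma psum_scal (a : C) (c : nat -> C) (q : C) N : psum (fun n => a * c n) q N = a * psum c q N.
Proof. by rewrite /psum big_distrr; apply: eq_bigr => i _ /=; ring. Qed.

Lemma Clim_psum (c : nat -> C) (q : C) :
  poly_growth c -> (Cmod q < 1)%R -> exists l, Clim (psum c q) l.
Proof.
move=> [M [k [M0 hc]]] hq.
suff [l hl] : @ex_series C_AbsRing C_NormedModule (fun n => c n * q ^ n).
  by exists l; exact: (proj1 (is_series_Clim _ _) hl).
apply: (@ex_series_le _ C_CompleteNormedModule _ (fun n => M * (INR n.+1 ^ k * Cmod q ^ n))%R).
  move=> n; change (Cmod (c n * q ^ n) <= M * (INR n.+1 ^ k * Cmod q ^ n))%R.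
  rewrite Cmod_mult Cmod_pow -Rmult_assoc.
  by apply: Rmult_le_compat_r => //; apply/pow_le/Cmod_ge_0.
apply: (@ex_series_scal_l R_AbsRing R_NormedModule M (fun n => INR n.+1 ^ k * Cmod q ^ n)%R).
by apply: ex_series_pow_geom; split=> //; exact: Cmod_ge_0.
Qed.

Lemma Cmod_pow_le (z : C) (r : R) (m n : nat) :
  (Cmod z <= r <= 1)%R -> (m <= n)%N -> (Cmod (z ^ n) <= r ^ m)%R.
Proof.
move=> [zr r1] mn; rewrite Cmod_pow.
apply: Rle_trans (pow_incr _ r n (conj (Cmod_ge_0 z) zr)) _.
rewrite -(subnK mn) pow_add -[X in (_ <= X)%R]Rmult_1_l.
apply: Rmult_le_compat_r; first by apply: pow_le; apply: Rle_trans zr; exact: Cmod_ge_0.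
by rewrite -(pow1 (n - m)); apply: pow_incr; split=> //; apply: Rle_trans zr; exact: Cmod_ge_0.
Qed.

Definition conv (c d : nat -> C) (n : nat) : C := \sum_(i < n.+1) (c i * d (n - i)%N).

(** The right side runs over the triangle [i + j < N]; passing to [N + 1] adds the antidiagonal
    [i + j = N]. *)
Lemma psum_conv (c d : nat -> C) (q : C) N :
  psum (conv c d) q N = \sum_(i < N) \sum_(j < N - i) (c i * q ^ i * (d j * q ^ j)).
Proof.
elim: N => [|N IH]; first by rewrite /psum !big_ord0.
rewrite /psum big_ord_recr /= -/(psum _ _ _) IH /conv [LHS]/= [RHS]big_ord_recr /=.
rewrite big_ord_recr /= subnn subSnn big_ord_recr big_ord0 /=.
have -> : \sum_(i < N) \sum_(j < N.+1 - i) (c i * q ^ i * (d j * q ^ j)) =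
  \sum_(i < N) \sum_(j < N - i) (c i * q ^ i * (d j * q ^ j)) +
  (\sum_(i < N) (c i * d (N - i)%N)) * q ^ N.
  rewrite big_distrl -big_split /=; apply: eq_bigr => i _.
  rewrite subSn ?(ltnW (ltn_ord i)) // big_ord_recr /=; congr (_ + _).
  have -> : q ^ N = q ^ i * q ^ (N - i)%N by rewrite -Cpow_add_r; congr Cpow; have := ltn_ord i; lia.
  ring.
by set X := \sum_(i < N) \sum_(j < _) _; set Y := \sum_(i < N) (c i * _); ring.
Qed.

Lemma sum_ord_split (F : nat -> C) (m n : nat) : (m <= n)%N ->
  \sum_(i < n) F i = \sum_(i < m) F i + \sum_(i < n - m) F (m + i)%N.
Proof.
move=> mn; rewrite -(big_mkord xpredT) (big_cat_nat (n := m)) //= big_mkord; congr (_ + _).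
by rewrite -{1}[m]add0n big_addn big_mkord; apply: eq_bigr => i _; rewrite addnC.
Qed.

(** The product of the partial sums runs over a square, [psum_conv] over a triangle. Their
    difference has at most [N ^ 2] terms, all with [i + j >= N]. *)
Lemma Clim_psum_conv (c d : nat -> C) (q l m : C) :
  (Cmod q < 1)%R -> poly_growth c -> poly_growth d ->
  Clim (psum c q) l -> Clim (psum d q) m -> Clim (psum (conv c d) q) (l * m).
Proof.
move=> hq [M [k [M0 hc]]] [M' [k' [M0' hd]]] hl hm.
have r0 := Cmod_ge_0 q; set r := Cmod q in hq r0 *.
(* The exponents [k] and [k'] bound the coefficients, and 2 accounts for the number of terms. *)
pose W N := (M * M' * (INR N.+1 ^ (k + k' + 2) * r ^ N))%R.
have hW : is_lim_seq W 0%R.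
  have := is_lim_seq_scal_l _ (M * M')%R _ (lim_pow_geom (k + k' + 2) (conj r0 hq)).
  by rewrite /= Rmult_0_r.
apply: (Clim_close (Clim_mul hl hm) _ hW) => N.
rewrite psum_conv /psum big_distrl /=.
have -> : \sum_(i < N) (c i * q ^ i * \sum_(j < N) (d j * q ^ j)) =
  \sum_(i < N) \sum_(j < N - i) (c i * q ^ i * (d j * q ^ j)) +
  \sum_(i < N) \sum_(j < N - (N - i)) (c i * q ^ i * (d (N - i + j)%N * q ^ (N - i + j)%N)).
  rewrite -big_split /=; apply: eq_bigr => i _; rewrite big_distrr /=.
  by rewrite (sum_ord_split (fun j => c i * q ^ i * (d j * q ^ j)) (leq_subr i N)).
set X := \sum_(i < N) _; set Y := \sum_(i < N) _.
have -> : X - (X + Y) = - Y by ring.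
rewrite Cmod_opp.
have N1 := INR_succ_ge1 N.
set B := (M * M' * (INR N.+1 ^ (k + k') * r ^ N))%R.
have B0 : (0 <= B)%R.
  apply: Rmult_le_pos; first exact: Rmult_le_pos.
  by apply: Rmult_le_pos; apply: pow_le => //; lra.
have -> : W N = (INR N.+1 * (INR N.+1 * B))%R by rewrite /W /B !pow_add; ring.
have NS : (INR N <= INR N.+1)%R by rewrite S_INR; lra.
apply: Rle_trans (Rmult_le_compat_r _ _ _ _ NS); last by apply: Rmult_le_pos => //; lra.
apply: (@Cmod_sum_le N (fun i => \sum_(j < N - (N - i))
  (c i * q ^ i * (d (N - i + j)%N * q ^ (N - i + j)%N)))) => i iN.
apply: Rle_trans (@Cmod_sum_le (N - (N - i))%N
  (fun j => c i * q ^ i * (d (N - i + j)%N * q ^ (N - i + j)%N)) B _) _.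
  move=> j ji.
  have -> : c i * q ^ i * (d (N - i + j)%N * q ^ (N - i + j)%N) =
            c i * d (N - i + j)%N * q ^ (i + (N - i + j))%N by rewrite (Cpow_add_r _ i); ring.
  rewrite !Cmod_mult.
  have hle (e p : nat) : (p < N)%N -> (INR p.+1 ^ e <= INR N.+1 ^ e)%R.
    move=> pN; apply: pow_incr; split; first exact: pos_INR.
    by apply: le_INR; lia.
  have h1 : (Cmod (c i) <= M * INR N.+1 ^ k)%R.
    by apply: Rle_trans (hc i) _; apply: Rmult_le_compat_l => //; apply: hle.
  have h2 : (Cmod (d (N - i + j)%N) <= M' * INR N.+1 ^ k')%R.
    by apply: Rle_trans (hd _) _; apply: Rmult_le_compat_l => //; apply: hle; lia.
  have h3 : (Cmod (q ^ (i + (N - i + j))%N) <= r ^ N)%R.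
    apply: Cmod_pow_le; [by split; [exact: Rle_refl | lra] | lia].
  have -> : B = (M * INR N.+1 ^ k * (M' * INR N.+1 ^ k') * r ^ N)%R by rewrite /B !pow_add; ring.
  apply: Rmult_le_compat => //; try exact: Cmod_ge_0.
    by apply: Rmult_le_pos; exact: Cmod_ge_0.
  by apply: Rmult_le_compat => //; exact: Cmod_ge_0.
by apply: Rmult_le_compat_r => //; apply: le_INR; lia.
Qed.

(** * Lambert series as power series *)

Definition lambertC (f : nat -> C) (eps : C) (n : nat) : C :=
  \sum_(d <- divs n) (f d * eps ^ (n %/ d).-1).

Lemma Cmod_pow_le1 (z : C) n : (Cmod z <= 1)%R -> (Cmod (z ^ n) <= 1)%R.
Proof. by move=> hz; apply: (@Cmod_pow_le z 1 0 n) => //; split=> //; exact: Rle_refl. Qed.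

(** There are at most [n] divisors, hence the exponent [k.+1]. *)
Lemma lambertC_growth (f : nat -> C) (eps : C) (k : nat) :
  (forall n, (Cmod (f n) <= INR n ^ k)%R) -> (Cmod eps <= 1)%R -> poly_growth (lambertC f eps).
Proof.
move=> hf heps; exists 1%R, k.+1; split; first lra.
move=> n; rewrite Rmult_1_l.
apply: Rle_trans (@Cmod_sum_seq_le _ _ _ (INR n.+1 ^ k)%R _) _.
  move=> d /dvd_div[d0 v0 e]; rewrite Cmod_mult -[X in (_ <= X)%R]Rmult_1_r.
  apply: Rmult_le_compat; try exact: Cmod_ge_0; last exact: Cmod_pow_le1.
  apply: Rle_trans (hf d) _; apply: pow_incr; split; first exact: pos_INR.
  by apply/le_INR/leP; rewrite -e leqW // leq_pmulr.
apply: Rmult_le_compat_r; first by apply/pow_le/pos_INR.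
apply/le_INR/leP; rewrite /divs size_filter.
by apply: leq_trans (count_size _ _) _; rewrite size_iota.
Qed.

Lemma geom_sum (x : C) (m : nat) : (1 - x) * \sum_(j < m) x ^ j = 1 - x ^ m.
Proof.
elim: m => [|m IH]; first by rewrite big_ord0 /=; ring.
by rewrite big_ord_recr /= Cmult_plus_distr_l IH; ring.
Qed.

(** Monomials of degree [d (j + 1) <= N] are grouped by degree on the left and by [d = k + 1] on the
    right. In the induction, [N %/ d] grows by one exactly when [d] divides [N + 1]. *)
Lemma psum_lambertC (f : nat -> C) (eps q : C) (N : nat) :
  psum (lambertC f eps) q N.+1 =
  \sum_(k < N) (f k.+1 * q ^ k.+1 * \sum_(j < N %/ k.+1) (eps * q ^ k.+1) ^ j).
Proof.
elim: N => [|N IH].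
  by rewrite /psum big_ord_recl !big_ord0 /lambertC big_nil; ring.
rewrite /psum big_ord_recr -/(psum _ _ _) IH /=.
have -> : \sum_(k < N) (f k.+1 * q ^ k.+1 * \sum_(j < N %/ k.+1) (eps * q ^ k.+1) ^ j) =
   \sum_(k < N.+1) (f k.+1 * q ^ k.+1 * \sum_(j < N %/ k.+1) (eps * q ^ k.+1) ^ j).
  rewrite [RHS]big_ord_recr /= divn_small ?ltnSn // big_ord0; ring.
have -> : lambertC f eps N.+1 * (q * q ^ N) = \sum_(k < N.+1)
    (if (k.+1 %| N.+1)%N then f k.+1 * q ^ k.+1 * (eps * q ^ k.+1) ^ (N %/ k.+1) else 0).
  rewrite /lambertC /divs big_filter big_distrl -[seq.iota 1 N.+1]/(index_iota 1 N.+2).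
  rewrite big_add1 big_mkord big_mkcond; apply: eq_bigr => k _ /=.
  case: ifP => // dk; rewrite divnS // dk add1n /=.
  have -> : q * q ^ N = q ^ (k.+1 * (N %/ k.+1).+1)%N.
    by rewrite -Cpow_S -{1}(divnK dk) divnS // dk mulnC.
  rewrite -!Cpow_S mulnS Cpow_add_r Cpow_mult_r; move: (q ^ k.+1) (N %/ k.+1)%N => y m.
  by rewrite Cpow_mult_l; ring.
rewrite -big_split; apply: eq_bigr => k _ /=.
rewrite -!Cpow_S divnS //; case: (k.+1 %| N.+1)%N; rewrite ?add0n ?add1n; last by rewrite Cplus_0_r.
by rewrite big_ord_recr /=; ring.
Qed.

Lemma Cmod_1_minus (x : C) : (1 - Cmod x <= Cmod (1 - x))%R.
Proof.
have := Cmod_triangle (1 - x) x; have -> : 1 - x + x = 1 by ring.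
rewrite Cmod_1; lra.
Qed.

(** By [psum_lambertC] the power series truncates each geometric series after [N %/ d] terms. The
    missing tails have degree above [N], and their denominators are at least [1 - r] in modulus. *)
Lemma lambert_series (f : nat -> C) (eps q l : C) (k : nat) :
  (forall n, (Cmod (f n) <= INR n ^ k)%R) -> (Cmod eps <= 1)%R -> (Cmod q < 1)%R ->
  Clim (psum (lambertC f eps) q) l ->
  @is_series C_AbsRing C_NormedModule
    (fun n => f n.+1 * q ^ n.+1 / (1 - eps * q ^ n.+1)) l.
Proof.
move=> hf heps hq hl0; have hl := proj2 (Clim_succ _ _) hl0.
apply/is_series_Clim.
have r0 := Cmod_ge_0 q; set r := Cmod q in hq r0 *.
pose W N := (/ (1 - r) * (INR N.+1 ^ k.+1 * r ^ N))%R.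
have hW : is_lim_seq W 0%R.
  have := is_lim_seq_scal_l _ (/ (1 - r))%R _ (lim_pow_geom k.+1 (conj r0 hq)).
  by rewrite /= Rmult_0_r.
apply: (Clim_close hl _ hW) => N; rewrite psum_lambertC.
set x := fun n => eps * q ^ n.+1.
have xr n : (Cmod (x n) <= r)%R.
  rewrite /x Cmod_mult -[r]Rmult_1_l -[r in (_ <= _ * r)%R]pow_1.
  apply: Rmult_le_compat => //; try exact: Cmod_ge_0.
  by apply: Cmod_pow_le => //; split; [exact: Rle_refl | lra].
have x1 n : (1 - r <= Cmod (1 - x n))%R by have := Cmod_1_minus (x n); have := xr n; lra.
have xn n : 1 - x n <> 0 by move=> e; have := x1 n; rewrite e Cmod_0; lra.
have -> : \sum_(n < N) (f n.+1 * q ^ n.+1 / (1 - x n)) =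
          \sum_(n < N) (f n.+1 * q ^ n.+1 * \sum_(j < N %/ n.+1) x n ^ j) +
          \sum_(n < N) (f n.+1 * (q ^ n.+1 * x n ^ (N %/ n.+1)) * / (1 - x n)).
  rewrite -big_split; apply: eq_bigr => n _ /=.
  have -> : \sum_(j < N %/ n.+1) x n ^ j = (1 - x n ^ (N %/ n.+1)) / (1 - x n).
    by rewrite -geom_sum; field; exact: xn.
  by rewrite -Cpow_S; move: (q ^ n.+1) (x n ^ _) => y z; field; exact: xn.
set X := \sum_(n < N) _; set Y := \sum_(n < N) _.
have -> : X + Y - X = Y by ring.
have -> : W N = (INR N.+1 * (INR N.+1 ^ k * r ^ N * / (1 - r)))%R by rewrite /W /=; ring.
have B0 : (0 <= INR N.+1 ^ k * r ^ N * / (1 - r))%R.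
  apply: Rmult_le_pos; last by apply/Rlt_le/Rinv_0_lt_compat; lra.
  by apply: Rmult_le_pos; apply: pow_le => //; exact: pos_INR.
have NS : (INR N <= INR N.+1)%R by rewrite S_INR; lra.
apply: Rle_trans (Rmult_le_compat_r _ _ _ B0 NS).
apply: (@Cmod_sum_le N (fun n => f n.+1 * (q ^ n.+1 * x n ^ (N %/ n.+1)) * / (1 - x n))) => n nN.
rewrite Cmod_mult Cmod_mult Cmod_inv; last exact: xn.
apply: Rmult_le_compat; try exact: Cmod_ge_0.
- by apply: Rmult_le_pos; exact: Cmod_ge_0.
- by apply/Rlt_le/Rinv_0_lt_compat; have := x1 n; lra.
- apply: Rmult_le_compat; try exact: Cmod_ge_0.
    apply: Rle_trans (hf _) _; apply: pow_incr; split; first exact: pos_INR.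
    by apply: le_INR; lia.
  have -> : q ^ n.+1 * x n ^ (N %/ n.+1) = eps ^ (N %/ n.+1) * q ^ (n.+1 * (N %/ n.+1).+1)%N.
    by rewrite /x Cpow_mult_l mulnS Cpow_add_r Cpow_mult_r; ring.
  rewrite Cmod_mult -[(r ^ N)%R]Rmult_1_l; apply: Rmult_le_compat; try exact: Cmod_ge_0.
    exact: Cmod_pow_le1.
  apply: Cmod_pow_le; first by split; [exact: Rle_refl | lra].
  (* The tail for [d] starts at degree [d (N %/ d + 1)], which exceeds [N]. *)
  by rewrite mulnC ltnW // ltn_ceil.
- by apply: Rinv_le_contravar; [lra | exact: x1].
Qed.

(** * Termwise differentiation of power series *)

Lemma Cmod_sum_series (w : nat -> R) :
  (forall n, 0 <= w n)%R -> ex_series w ->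
  exists B, (0 <= B)%R /\ forall (A : R) (F : nat -> C), (0 <= A)%R ->
    (forall n, (Cmod (F n) <= A * w n)%R) -> forall N, (Cmod (\sum_(n < N) F n) <= A * B)%R.
Proof.
move=> w0 hw.
have hle N : (sum_n w N <= Series w)%R.
  apply: is_lim_seq_incr_compare; first exact: Series_correct.
  by move=> n; rewrite sum_Sn /plus /=; have := w0 n.+1; lra.
have B0 : (0 <= Series w)%R by apply: Rle_trans (hle 0%N); rewrite sum_O.
exists (Series w); split=> // A F A0 hF [|N].
  by rewrite big_ord0 Cmod_0; exact: Rmult_le_pos.
apply: Rle_trans (Rmult_le_compat_l _ _ _ A0 (hle N)).
elim: N => [|N IH]; first by rewrite sum_O big_ord_recl big_ord0 /= Cplus_0_r; exact: hF.
rewrite big_ord_recr sum_Sn /plus /= Rmult_plus_distr_l.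
by apply: Rle_trans (Cmod_triangle _ _) _; apply: Rplus_le_compat IH (hF _).
Qed.

(** The remainder of the first-order Taylor expansion of [z ^ n.+1] at [q]. *)
Definition pow_rem (z q : C) (n : nat) : C :=
  z ^ n.+1 - q ^ n.+1 - INR n.+1 * q ^ n * (z - q).

(** Each step multiplies the remainder by [z] and adds [(n + 1) q ^ n (z - q) ^ 2]; then
    [(n + 1) ^ 2 + (n + 1) <= (n + 2) ^ 2] suffices. The factor [rho] on the left avoids the
    exponent [n - 1]. *)
Lemma pow_rem_le (z q : C) (rho : R) (n : nat) :
  (0 < rho)%R -> (Cmod z <= rho)%R -> (Cmod q <= rho)%R ->
  (Cmod (pow_rem z q n) * rho <= Cmod (z - q) ^ 2 * (INR n.+1 ^ 2 * rho ^ n))%R.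
Proof.
move=> rho0 hz hq; set h := Cmod (z - q); have h0 : (0 <= h)%R := Cmod_ge_0 _.
elim: n => [|n IH].
  have -> : pow_rem z q 0 = 0 by rewrite /pow_rem /=; ring.
  by rewrite Cmod_0 /=; have := pow2_ge_0 h; rewrite /=; lra.
have -> : pow_rem z q n.+1 = z * pow_rem z q n + INR n.+1 * q ^ n * (z - q) * (z - q).
  by rewrite /pow_rem (S_INR n.+1) RtoC_plus !(Cpow_S _ n.+1) !(Cpow_S _ n); ring.
have hn := pos_INR n.+1.
have hp : (0 <= rho ^ n)%R by apply: pow_le; lra.
have hqn : (Cmod q ^ n <= rho ^ n)%R by apply: pow_incr; split=> //; exact: Cmod_ge_0.
apply: (@Rle_trans _ ((rho * Cmod (pow_rem z q n) + INR n.+1 * rho ^ n * h * h) * rho)%R).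
  apply: Rmult_le_compat_r; first lra.
  apply: Rle_trans (Cmod_triangle _ _) _; apply: Rplus_le_compat.
    by rewrite Cmod_mult; apply: Rmult_le_compat_r => //; exact: Cmod_ge_0.
  rewrite !Cmod_mult Cmod_R Rabs_pos_eq // Cmod_pow.
  by do 2!(apply: Rmult_le_compat_r => //); apply: Rmult_le_compat_l.
rewrite (S_INR n.+1) -(tech_pow_Rmult rho).
have hA : (0 <= h ^ 2 * (rho ^ n * rho))%R.
  by apply: Rmult_le_pos; [exact: pow2_ge_0 | apply: Rmult_le_pos => //; lra].
have := Rmult_le_compat_l rho _ _ (Rlt_le _ _ rho0) IH.
set P := Cmod _; set a := INR n.+1 in hn *; nra.
Qed.

Lemma Cmod_le_is_derive (F : C -> C) (q D : C) (del K : R) :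
  (0 < del)%R -> (0 <= K)%R ->
  (forall z, (Cmod (z - q) < del)%R -> (Cmod (F z - F q - (z - q) * D) <= Cmod (z - q) ^ 2 * K)%R) ->
  @is_derive C_AbsRing C_NormedModule F q D.
Proof.
move=> del0 K0 h; split; first exact: is_linear_scal_l.
move=> x /is_filter_lim_locally_unique <- eps.
(* [K + 1] replaces [K], which may be 0, as divisor. *)
have e0 : (0 < Rmin del (eps / (K + 1)))%R.
  by apply: Rmin_pos => //; apply: Rdiv_lt_0_compat; [exact: cond_pos | lra].
exists (mkposreal _ e0) => z hz.
have {}hz : (Cmod (z - q) < Rmin del (eps / (K + 1)))%R := hz.
have h1 := Rlt_le_trans _ _ _ hz (Rmin_l _ _); have h2 := Rlt_le_trans _ _ _ hz (Rmin_r _ _).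
change (Cmod (F z - F q - (z - q) * D) <= eps * Cmod (z - q))%R.
apply: Rle_trans (h z h1) _.
have c0 := Cmod_ge_0 (z - q).
have h3 : (Cmod (z - q) * (K + 1) <= eps)%R.
  have := Rmult_le_compat_r (K + 1) _ _ _ (Rlt_le _ _ h2); rewrite /Rdiv Rmult_assoc Rinv_l; lra.
have := Rmult_le_compat_l _ _ _ c0 h3; nra.
Qed.

Lemma psum_derive (c : nat -> C) (F : C -> C) (q : C) :
  poly_growth c -> (forall z, (Cmod z < 1)%R -> Clim (psum c z) (F z)) -> (Cmod q < 1)%R ->
  exists D, @is_derive C_AbsRing C_NormedModule F q D /\
    Clim (psum (fun n => INR n * c n) q) (q * D).
Proof.
move=> [M [k [M0 hc]]] hF hq.
(* All [z] within [rho - Cmod q] of [q] stay in the disc of radius [rho < 1]. *)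
have r0 := Cmod_ge_0 q; pose rho := ((Cmod q + 1) / 2)%R.
have rho0 : (0 < rho)%R by rewrite /rho; lra.
have rho1 : (rho < 1)%R by rewrite /rho; lra.
have hqr : (Cmod q < rho)%R by rewrite /rho; lra.
pose c' := fun n => INR n.+1 * c n.+1.
have INR0 n : (0 <= INR n.+1)%R := pos_INR _.
(* The factor [2 ^ k] comes from [n + 2 <= 2 (n + 1)]. *)
have hc1 n : (Cmod (c n.+1) <= M * 2 ^ k * INR n.+1 ^ k)%R.
  apply: Rle_trans (hc _) _; rewrite Rmult_assoc -Rpow_mult_distr.
  apply: Rmult_le_compat_l => //; apply: pow_incr; split=> //.
  by rewrite (S_INR n.+1); have := INR_succ_ge1 n; lra.
have M2 : (0 <= M * 2 ^ k)%R by apply: Rmult_le_pos => //; apply: pow_le; lra.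
have hc' : poly_growth c'.
  exists (M * 2 ^ k)%R, k.+1; split=> // n.
  rewrite /c' Cmod_mult Cmod_R Rabs_pos_eq //.
  have -> : (M * 2 ^ k * INR n.+1 ^ k.+1 = INR n.+1 * (M * 2 ^ k * INR n.+1 ^ k))%R.
    by rewrite -tech_pow_Rmult; ring.
  exact: Rmult_le_compat_l.
(* [D] is the sum of the termwise differentiated series. *)
have [D hD] := Clim_psum hc' hq; exists D; split; last first.
  apply/Clim_succ; apply: (Clim_ext (u := fun N => q * psum c' q N)); last exact: Clim_scal.
  move=> N; rewrite /psum big_ord_recl big_distrr [INR (nat_of_ord ord0)]/= !Cmult_0_l Cplus_0_l.
  by apply: eq_bigr => i _; rewrite /c' lift0; move: (INR _) => x /=; ring.
have rr : (0 <= rho < 1)%R by lra.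
(* [B] depends only on the weights, so it serves every [z]. The exponent adds the 2 of [pow_rem_le]
   to the growth of the coefficients. *)
have [B [B0 hB]] := Cmod_sum_series (w := fun n => (INR n.+1 ^ (k + 2) * rho ^ n)%R)
  (fun n => Rmult_le_pos _ _ (pow_le _ _ (INR0 n)) (pow_le _ _ (proj1 rr)))
  (ex_series_pow_geom (k + 2) rr).
apply: (Cmod_le_is_derive (del := rho - Cmod q) (K := M * 2 ^ k / rho * B)).
- lra.
- apply: Rmult_le_pos => //; apply: Rmult_le_pos => //; exact/Rlt_le/Rinv_0_lt_compat.
move=> z hz.
have hzr : (Cmod z < rho)%R.
  have := Cmod_triangle (z - q) q; have -> : z - q + q = z by ring.
  lra.
have hz1 : (Cmod z < 1)%R by lra.
(* The error of the linear approximation is itself a series of remainders; the constant term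
   cancels. *)
have hlim : Clim (fun N => \sum_(n < N) (c n.+1 * pow_rem z q n)) (F z - F q - (z - q) * D).
  have hlz := proj2 (Clim_succ _ _) (hF z hz1); have hlq := proj2 (Clim_succ _ _) (hF q hq).
  have := Clim_add hlz (Clim_add (Clim_scal (- (1)) hlq) (Clim_scal (- (z - q)) hD)).
  have -> : F z + (- (1) * F q + - (z - q) * D) = F z - F q - (z - q) * D by ring.
  apply: Clim_ext => N; rewrite /psum big_ord_recl [X in _ + (- (1) * X + _)]big_ord_recl.
  set X := \sum_(i < N) _; set Y := \sum_(i < N) _; set Z := \sum_(i < N) _.
  have -> : c 0%N * z ^ 0 + X + (- (1) * (c 0%N * q ^ 0 + Y) + - (z - q) * Z) =
    X + (- (1) * Y + - (z - q) * Z) by rewrite /=; ring.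
  rewrite /X /Y /Z !big_distrr -!big_split; apply: eq_bigr => i _.
  by rewrite /c' /pow_rem !lift0; move: (INR _) => x /=; ring.
have -> : (Cmod (z - q) ^ 2 * (M * 2 ^ k / rho * B) = Cmod (z - q) ^ 2 * (M * 2 ^ k / rho) * B)%R.
  by ring.
apply: (Clim_Cmod_le hlim) => N; apply: (hB _ (fun n => c n.+1 * pow_rem z q n)).
  apply: Rmult_le_pos; first exact: pow2_ge_0.
  by apply: Rmult_le_pos => //; exact/Rlt_le/Rinv_0_lt_compat.
move=> n; rewrite Cmod_mult.
have := pow_rem_le n rho0 (Rlt_le _ _ hzr) (Rlt_le _ _ hqr); set P := Cmod (pow_rem _ _ _) => hP.
have {}hP : (P <= Cmod (z - q) ^ 2 * (INR n.+1 ^ 2 * rho ^ n) / rho)%R.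
  have := Rmult_le_compat_r _ _ _ (Rlt_le _ _ (Rinv_0_lt_compat _ rho0)) hP.
  by rewrite Rmult_assoc Rinv_r ?Rmult_1_r //; lra.
have P0 : (0 <= P)%R := Cmod_ge_0 _.
apply: Rle_trans (Rmult_le_compat _ _ _ _ (Cmod_ge_0 _) P0 (hc1 n) hP) _.
by apply: Req_le; rewrite pow_add; field; lra.
Qed.

(** * The differential equation *)

Definition ZtoC (z : Z) : C := IZR z.

Lemma ZtoC_add (x y : Z) : ZtoC (x + y)%ring = ZtoC x + ZtoC y.
Proof. by rewrite /ZtoC plus_IZR RtoC_plus. Qed.

Lemma ZtoC_mul (x y : Z) : ZtoC (x * y)%ring = ZtoC x * ZtoC y.
Proof. by rewrite /ZtoC mult_IZR RtoC_mult. Qed.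

Lemma ZtoC_nat (n : nat) : ZtoC (n%:R)%ring = INR n.
Proof.
elim: n => [//|n IH].
by rewrite S_INR RtoC_plus -IH -GRing.natr1 ZtoC_add.
Qed.

Lemma ZtoC_exp (x : Z) (n : nat) : ZtoC (x ^+ n)%ring = ZtoC x ^ n.
Proof. by elim: n => [//|n IH]; rewrite GRing.exprS ZtoC_mul IH. Qed.

Lemma ZtoC_sum (I : Type) (s : seq I) (P : pred I) (F : I -> Z) :
  ZtoC (\sum_(i <- s | P i) F i)%ring = \big[Cplus/RtoC 0]_(i <- s | P i) ZtoC (F i).
Proof. exact: (big_morph ZtoC ZtoC_add (erefl _)). Qed.

Lemma ZtoC_lambert (f : nat -> Z) (eps : Z) (n : nat) :
  ZtoC (lambert f eps n) = lambertC (fun d => ZtoC (f d)) (ZtoC eps) n.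
Proof.
rewrite /lambert ZtoC_sum; apply: eq_bigr => d _.
by rewrite ZtoC_mul ZtoC_exp.
Qed.

Lemma Csum1_unique (a : nat -> C) (l : C) :
  @is_series C_AbsRing C_NormedModule (fun k => a (S k)) l -> Csum1 a = l.
Proof.
move=> h; apply: (@iota_unique C_AbsRing C_CompleteNormedModule) (h) => y hy.
exact: Clim_unique (proj1 (is_series_Clim _ _) hy) (proj1 (is_series_Clim _ _) h).
Qed.

Definition lambert_coef (a : Z) (f : nat -> Z) (eps : Z) (n : nat) : C :=
  ZtoC ((n == 0%N)%:R + a * lambert f eps n)%ring.

(** This treats the three functions at once: [eps] is -1 for [fun_e] and 1 for [fun_P] and [fun_Q],
    and [k] is the degree of [f]. *)
Lemma lambert_coef_lim (a : Z) (f : nat -> Z) (eps : Z) (k : nat) (b : nat -> C) (q : C) :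
  (forall n, (Cmod (ZtoC (f n)) <= INR n ^ k)%R) -> (Cmod (ZtoC eps) <= 1)%R -> (Cmod q < 1)%R ->
  (forall n, b n.+1 = ZtoC (f n.+1) * q ^ n.+1 / (1 - ZtoC eps * q ^ n.+1)) ->
  poly_growth (lambert_coef a f eps) /\
  Clim (psum (lambert_coef a f eps) q) (1 + ZtoC a * Csum1 b).
Proof.
move=> hf heps hq hb; set L := lambertC (fun d => ZtoC (f d)) (ZtoC eps).
have eL n : lambert_coef a f eps n = INR (n == 0%N) + ZtoC a * L n.
  by rewrite /lambert_coef ZtoC_add ZtoC_nat ZtoC_mul ZtoC_lambert.
have hL : poly_growth L := lambertC_growth hf heps.
split.
  have [M [j [M0 hM]]] := hL; exists (1 + Cmod (ZtoC a) * M)%R, j.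
  have ha := Rmult_le_pos _ _ (Cmod_ge_0 (ZtoC a)) M0.
  split=> [|n]; first lra.
  rewrite eL; apply: Rle_trans (Cmod_triangle _ _) _.
  rewrite Rmult_plus_distr_r Cmod_mult Cmod_R Rabs_pos_eq; last exact: pos_INR.
  apply: Rplus_le_compat.
    rewrite Rmult_1_l; apply: Rle_trans (pow_R1_Rle _ j (INR_succ_ge1 n)).
    by case: (n == 0%N) => /=; lra.
  by rewrite Rmult_assoc; apply: Rmult_le_compat_l => //; exact: Cmod_ge_0.
have [l hl] := Clim_psum hL hq.
have -> : Csum1 b = l.
  apply: Csum1_unique; apply: is_series_ext (lambert_series hf heps hq hl) => n.
  by rewrite hb.
have h1 : Clim (psum (fun n => INR (n == 0%N)) q) 1.
  apply/Clim_succ; apply: (Clim_ext (u := fun=> 1)); last exact: Clim_const.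
  move=> N; rewrite /psum big_ord_recl big1 /= => [|i _]; ring.
apply: Clim_ext (Clim_add h1 (Clim_scal (ZtoC a) hl)) => N.
by rewrite -psum_scal -psum_add; apply: eq_bigr => i _; rewrite eL.
Qed.

Lemma ZtoC_sg (n : nat) : ZtoC (sg n) = (- (1)) ^ n.
Proof. by rewrite ZtoC_exp -RtoC_opp. Qed.

Lemma Cmod_sg (n : nat) : Cmod (ZtoC (sg n)) = 1%R.
Proof. by rewrite ZtoC_sg Cmod_pow Cmod_m1 pow1. Qed.

Lemma coef_e_lim (q : C) : (Cmod q < 1)%R ->
  poly_growth (fun n => ZtoC (coef_e n)) /\ Clim (psum (fun n => ZtoC (coef_e n)) q) (fun_e q).
Proof.
move=> hq; apply: (@lambert_coef_lim _ _ _ 1) => // [n||n].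
- by rewrite ZtoC_nat Cmod_R Rabs_pos_eq ?pow_1; [exact: Rle_refl | exact: pos_INR].
- by rewrite Cmod_R Rabs_Ropp Rabs_R1; exact: Rle_refl.
have -> : ZtoC (- 1)%ring = - (1) by rewrite -RtoC_opp.
by rewrite ZtoC_nat; congr (_ / _); ring.
Qed.

Lemma coef_P_lim (q : C) : (Cmod q < 1)%R ->
  poly_growth (fun n => ZtoC (coef_P n)) /\ Clim (psum (fun n => ZtoC (coef_P n)) q) (fun_P q).
Proof.
move=> hq; apply: (@lambert_coef_lim _ _ _ 1) => // [n||n].
- rewrite ZtoC_mul Cmod_mult Cmod_sg Rmult_1_l ZtoC_nat Cmod_R Rabs_pos_eq ?pow_1.
    exact: Rle_refl.
  exact: pos_INR.
- by rewrite Cmod_R Rabs_R1; exact: Rle_refl.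
have -> : Nat.sub n.+1 1 = n by lia.
by rewrite ZtoC_mul ZtoC_sg ZtoC_nat Cmult_1_l.
Qed.

Lemma coef_Q_lim (q : C) : (Cmod q < 1)%R ->
  Clim (psum (fun n => ZtoC (coef_Q n)) q) (fun_Q q).
Proof.
move=> hq; rewrite /fun_Q.
have -> : forall s : C, 1 - 16 * s = 1 + ZtoC (-16) * s by move=> s; rewrite /ZtoC; ring.
pose f := fun d : nat => (sg d.-1 * d%:R ^+ 3)%ring.
apply: (Clim_ext (u := psum (lambert_coef (-16) f 1%Z) q)).
  by move=> N; apply: eq_bigr => n _; rewrite /coef_Q -Z.add_opp_r -Z.mul_opp_l.
apply: (proj2 (@lambert_coef_lim _ f 1%Z 3 _ q _ _ hq _)) => [n||n].
- rewrite ZtoC_mul Cmod_mult Cmod_sg Rmult_1_l ZtoC_exp ZtoC_nat Cmod_pow Cmod_R Rabs_pos_eq.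
    exact: Rle_refl.
  exact: pos_INR.
- by rewrite Cmod_R Rabs_R1; exact: Rle_refl.
have -> : Nat.sub n.+1 1 = n by lia.
by rewrite ZtoC_mul ZtoC_sg ZtoC_exp ZtoC_nat Cmult_1_l.
Qed.

Theorem theorem2p4 (q : C) (hq : (Cmod q < 1)%R) :
  @ex_derive C_AbsRing C_NormedModule fun_e q /\
  q * C_derive fun_e q = (fun_e q * fun_P q - fun_Q q) / 2.
Proof.
have [ge le] := coef_e_lim hq; have [gP lP] := coef_P_lim hq; have lQ := coef_Q_lim hq.
have [D [hD lD]] := psum_derive ge (fun z hz => (coef_e_lim hz).2) hq.
split; first by exists D.
rewrite (is_C_derive_unique _ _ _ hD).
(* The power series with the convolved coefficients tends to the product, and by [coef_ode] also to
   [fun_Q q + 2 * (q * D)]. *)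
have e := Clim_unique (Clim_psum_conv hq ge gP le lP) (_ : Clim _ (fun_Q q + 2 * (q * D))).
rewrite e; first by field; move=> /RtoC_inj; lra.
apply: Clim_ext (Clim_add lQ (Clim_scal 2 lD)) => N.
rewrite -psum_scal -psum_add; apply: eq_bigr => n _; congr (_ * _).
rewrite -ZtoC_nat -ZtoC_mul -[RtoC 2]/(ZtoC 2) -ZtoC_mul -coef_ode -ZtoC_add GRing.addrC GRing.subrK.
by rewrite ZtoC_sum; apply: eq_bigr => i _; rewrite ZtoC_mul.
Qed.
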